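(* Let $N$ be a smooth connected manifold, Riemannian-embedded in a matrix algebra $\mathcal M$ with $0\in N$. Then $L^2_0(S^1,N)=L^2(S^1,N)$. Moreover, every loop $\gamma\in C^\infty(S^1,N)$ is connected, by a continuous path in $L^2(S^1,N)$, to a null-homotopic piecewise smooth loop.
   Context: $\mathcal M$ is an algebra of complex matrices with Hermitian product $(A,B)\mapsto \mathrm{tr}(AB^* )$. $S^1=\mathbb R/\mathbb Z$. For $s\in\mathbb R$, $H^s(S^1,\mathcal M)$ is the completion of $C^\infty(S^1,\mathcal M)$ for the norm $\|f\|_s^2=\sum_{n\in\mathbb Z}(1+|n|)^{2s}\|f_n\|^2$, $f_n$ the Fourier coefficients; $L^2=H^0$. $H^s(S^1,N)$ is the closure of $C^\infty(S^1,N)$ in $H^s(S^1,\mathcal M)$, and $H^s_0(S^1,N)$ is the closure in $H^s(S^1,\mathcal M)$ of the based loops $C^\infty_0(S^1,N)=\{\gamma\in C^\infty(S^1,N):\gamma(0)=0\}$. $L^2(S^1,N)$ and $L^2_0(S^1,N)$ carry the topology induced by the $L^2$-norm. *)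

(* Defs.v *)
From mathcomp Require Import all_boot all_order all_algebra.
From mathcomp Require Import all_classical all_reals all_analysis.
Import numFieldNormedType.Exports.
Import Order.TTheory GRing.Theory Num.Theory.

Set Implicit Arguments.
Unset Strict Implicit.
Unset Printing Implicit Defensive.

Local Open Scope classical_set_scope.
Local Open Scope ring_scope.

Section Defs.
Variable R : realType.

(** The matrix algebra M_n(C), realified: a complex matrix A = X + i Y is
    represented by the pair (X, Y) of real matrices. *)
Local Notation cmx n := ('M[R]_n * 'M[R]_n)%type.

Definition fro2 (n : nat) (A : cmx n) : R :=
  \sum_(i < n) \sum_(j < n) ((A.1 i j) ^+ 2 + (A.2 i j) ^+ 2).

Fixpoint iter_dir {V W : normedModType R} (vs : seq V) (f : V -> W) : V -> W :=
  match vs with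
  | [::] => f
  | v :: vs' => 'D_v (iter_dir vs' f)
  end.

Definition smooth_on {V W : normedModType R} (U : set V) (f : V -> W) : Prop :=
  forall (vs : seq V) (x : V), U x ->
    {for x, continuous (iter_dir vs f)} /\
    (forall v : V, derivable (iter_dir vs f) x v).

Definition lsubspace {V : lmodType R} (E : set V) : Prop :=
  E 0 /\ forall (a : R) (x y : V), E x -> E y -> E (a *: x + y).

Definition submanifold {V : normedModType R} (N : set V) : Prop :=
  forall p : V, N p ->
    exists (U U' : set V) (Phi Psi : V -> V) (E : set V),
      [/\ [/\ open U, U p, open U' & lsubspace E],
          smooth_on U Phi /\ smooth_on U' Psi,
          (forall x, U x -> U' (Phi x) /\ Psi (Phi x) = x),
          (forall y, U' y -> U (Psi y) /\ Phi (Psi y) = y) &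
          (forall x, U x -> (N x <-> E (Phi x)))].

(** Loops S^1 = R/Z -> M are 1-periodic maps R -> M. *)
Definition periodic1 {T : Type} (g : R -> T) : Prop := forall x : R, g (x + 1) = g x.

Definition smooth_loops (n : nat) (N : set (cmx n)) : set (R -> cmx n) :=
  [set g | periodic1 g /\ smooth_on setT g /\ (forall x, N (g x))].

Definition based_smooth_loops (n : nat) (N : set (cmx n)) : set (R -> cmx n) :=
  [set g | smooth_loops N g /\ g 0 = 0].

Definition l2sq (n : nat) (f g : R -> cmx n) : \bar R :=
  (\int[@lebesgue_measure R]_(x in `[0%R, 1%R]) (fro2 (f x - g x))%:E)%E.

Definition L2mem (n : nat) (f : R -> cmx n) : Prop :=
  (forall i j : 'I_n, measurable_fun setT (fun x => (f x).1 i j) /\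
                      measurable_fun setT (fun x => (f x).2 i j)) /\
  (l2sq f (fun=> 0%R) < +oo)%E.

Definition L2closure (n : nat) (S : set (R -> cmx n)) : set (R -> cmx n) :=
  [set f | L2mem f /\
     forall e : R, 0 < e -> exists2 g, S g & (l2sq f g < e%:E)%E].

Definition L2loops (n : nat) (N : set (cmx n)) := L2closure (smooth_loops N).
Definition L2loops0 (n : nat) (N : set (cmx n)) := L2closure (based_smooth_loops N).

Definition piecewise_smooth_loop (n : nat) (N : set (cmx n)) (s : R -> cmx n) : Prop :=
  [/\ periodic1 s, continuous s, (forall x, N (s x)) &
    exists a : seq R,
      [/\ sorted <%R (0 :: a), last 0 a = 1 &
        forall i : nat, (i < size a)%N ->
          exists2 h : R -> cmx n, smooth_on setT h &
            forall x, nth 0 (0 :: a) i <= x <= nth 0 a i -> h x = s x]].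

Definition null_homotopic (n : nat) (N : set (cmx n)) (s : R -> cmx n) : Prop :=
  exists (H : R -> R -> cmx n) (c : cmx n),
    [/\ continuous (fun p : R * R => H p.1 p.2),
        (forall x, H 0 x = s x),
        (forall x, H 1 x = c),
        (forall t x, 0 <= t <= 1 -> H t (x + 1) = H t x) &
        (forall t x, 0 <= t <= 1 -> N (H t x))].

Definition L2_continuous_path (n : nat) (p : R -> R -> cmx n) : Prop :=
  forall t0 : R, 0 <= t0 <= 1 -> forall e : R, 0 < e ->
    exists2 d : R, 0 < d & forall t : R, 0 <= t <= 1 -> `|t - t0| < d ->
      (l2sq (p t) (p t0) < e%:E)%E.

End Defs.

Notation cmx R n := ('M[R]_n * 'M[R]_n)%type.

(* Main.v *)
Require Import Defs.
From mathcomp Require Import all_boot all_order all_algebra.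
From mathcomp Require Import all_classical all_reals all_analysis.
From mathcomp Require Import measurable_realfun ring lra.
Import numFieldNormedType.Exports.
Import Order.TTheory GRing.Theory Num.Theory.
Local Open Scope classical_set_scope.
Local Open Scope ring_scope.
(* The L2 topology does not see what a loop does on a short time interval.
   Charts of [N] and connectedness provide, between any two points of [N], a
   smooth path in [N] that is locally constant outside [0, 1]. Given a smooth
   curve [g] in [N] and a base point [b] in [N], run from [b] to [g 0] in time
   [d], follow [g] (at rest at [g 0] near times [d] and [1 - d]), and run back
   to [b]: this is a smooth loop based at [b], bounded uniformly in [d], which
   equals [g] except on a set of measure O(d). With [g] a loop and [b = 0] it
   shows that based loops are dense. With [g x = gamma ((1 - t) x)] and
   [b = gamma 0] it puts the possibly discontinuous loop
   [x |-> gamma ((1 - t) frac x)] in the L2 closure; as [t] goes from 0 to 1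
   these loops deform [gamma] to a constant. *)

(** * Calculus of k times differentiable curves *)

Section Ck.
Context {R : realType}.
Implicit Types (V : normedModType R) (D : set R) (k : nat).

(** Continuity of the last derivative is not asked for. This gives the recursion [CkSP], on which
    the sum, product and chain rules go by induction on [k]; smoothness is [Ck k] for every [k]. *)
Definition Ck {V} k D (f : R -> V) :=
  forall j, (j < k)%N -> forall x, D x -> derivable (derive1n j f) x 1.

Lemma CkSP {V} k D (f : R -> V) :
  Ck k.+1 D f <-> (forall x, D x -> derivable f x 1) /\ Ck k D (derive1 f).
Proof.
split=> [H|[H1 H2] [|j] jk x Dx].
- split=> [x Dx|j jk x Dx]; first exact: (H 0%N).
  by rewrite -derive1Sn; exact: H.
- exact: H1.
- by rewrite derive1Sn; exact: H2.
Qed.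

Lemma Ck_le {V} k l D (f : R -> V) : (l <= k)%N -> Ck k D f -> Ck l D f.
Proof. by move=> lk H j jl; apply: H; apply: leq_trans lk. Qed.

Lemma near_eq_derive1 {V} (f g : R -> V) (x : R) :
  (\near x, f x = g x) -> derive1 f x = derive1 g x.
Proof. by move=> fg; rewrite !derive1E; exact: near_eq_derive. Qed.

Lemma near_eq_derive1n {V} (f g : R -> V) j (x : R) :
  (\near x, f x = g x) -> \near x, (derive1n j f) x = (derive1n j g) x.
Proof.
move=> fg; elim: j => [//|j IH].
move: (near_join IH); apply: filterS => y yE.
by rewrite !derive1nS; exact: near_eq_derive1.
Qed.

(** Derivatives of every order depend only on the germ, so each point may come with its own [g].
    This allows functions given by different formulas in different places. *)
Lemma Ck_near {V} k D (f : R -> V) :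
  (forall x, D x -> exists2 g : R -> V, (\near x, g x = f x) & Ck k D g) ->
  Ck k D f.
Proof.
move=> H j jk x Dx; have [g gf kg] := H _ Dx.
apply: near_eq_derivable (kg _ jk _ Dx).
exact: near_eq_derive1n.
Qed.

Lemma Ck_eq {V} k D (f g : R -> V) : open D -> (forall x, D x -> g x = f x) ->
  Ck k D g -> Ck k D f.
Proof.
move=> oD gf kg; apply: Ck_near => x Dx; exists g => //.
by near=> y; apply: gf; near: y; exact: open_nbhs_nbhs.
Unshelve. all: by end_near. Qed.

Lemma Ck_cst {V} k D (a : V) : Ck k D (fun=> a).
Proof.
elim: k a => [//|k IH] a; apply/CkSP; split=> [x _|].
  exact: derivable_cst.
rewrite (_ : derive1 _ = fun=> 0) //.
by apply/funext => x; rewrite derive1_cst.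
Qed.

Lemma CkD {V} k D (f g : R -> V) : open D ->
  Ck k D f -> Ck k D g -> Ck k D (fun x => f x + g x).
Proof.
move=> oD; elim: k f g => [//|k IH] f g /CkSP[df kf] /CkSP[dg kg].
apply/CkSP; split=> [x Dx|].
  by apply: derivableD; [exact: df|exact: dg].
apply: (Ck_eq _ _ _ (fun x => derive1 f x + derive1 g x)) => //; last exact: IH.
by move=> x Dx; rewrite !derive1E deriveD//; [exact: df|exact: dg].
Qed.

Lemma is_derive_scale {V} (a : R -> R) (f : R -> V) x :
  derivable a x 1 -> derivable f x 1 ->
  is_derive x 1 (fun x => a x *: f x) (derive1 a x *: f x + a x *: derive1 f x).
Proof.
move=> da df; suff H : h^-1 *: (a (h + x) *: f (h + x) - a x *: f x)
    @[h --> 0^'] --> derive1 a x *: f x + a x *: derive1 f x.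
  have E : (fun h : R => h^-1 *: (((fun x => a x *: f x) \o shift x) (h *: 1)
      - a x *: f x)) = (fun h => h^-1 *: (a (h + x) *: f (h + x) - a x *: f x)).
    by apply/funext => h /=; rewrite [h *: 1]mulr1.
  apply: DeriveDef; rewrite /derivable /derive E; first exact: cvgP H.
  exact: cvg_lim H.
have E1 (V' : normedModType R) (g : R -> V') : derivable g x 1 ->
    h^-1 *: (g (h + x) - g x) @[h --> 0^'] --> derive1 g x.
  rewrite derive1E /derivable /derive => dg; under eq_fun => h.
    by rewrite -[X in X + x](mulr1 h); over.
  exact: dg.
have fx : f (h + x) @[h --> 0^'] --> f x.
  have /derivable1_diffP/differentiable_continuous := df.
  move=> /(continuous_withinNshiftx _ x) /=; exact.
have -> : (fun h => h^-1 *: (a (h + x) *: f (h + x) - a x *: f x)) =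
    (fun h => (h^-1 *: (a (h + x) - a x)) *: f (h + x) +
              a x *: (h^-1 *: (f (h + x) - f x))).
  apply/funext => h; rewrite !scalerBr scalerBl !scalerA [a x * _]mulrC.
  by rewrite addrA subrK.
apply: cvgD; apply: cvgZ; [exact: E1|exact: fx|exact: cvg_cst|exact: E1].
Qed.

Lemma Ck_scale {V} k D (a : R -> R) (f : R -> V) : open D ->
  Ck k D a -> Ck k D f -> Ck k D (fun x => a x *: f x).
Proof.
move=> oD; elim: k a f => [//|k IH] a f ka' kf'.
have /CkSP[da ka] := ka'; have /CkSP[df kf] := kf'.
have H x : D x ->
    is_derive x 1 (fun x => a x *: f x)
      (derive1 a x *: f x + a x *: derive1 f x).
  by move=> Dx; apply: is_derive_scale; [exact: da|exact: df].
apply/CkSP; split=> [x /H[]//|].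
apply: (Ck_eq _ _ _ (fun x => derive1 a x *: f x + a x *: derive1 f x)) => //.
  by move=> x /H[_ <-]; rewrite derive1E.
apply: CkD => //; first exact: IH ka (Ck_le _ _ _ _ (leqnSn k) kf').
exact: IH (Ck_le _ _ _ _ (leqnSn k) ka') kf.
Qed.

Lemma is_derive_comp {V} (f : R -> R) (g : R -> V) x :
  derivable f x 1 -> derivable g (f x) 1 ->
  is_derive x 1 (g \o f) (derive1 f x *: derive1 g (f x)).
Proof.
move=> /derivable1_diffP df /derivable1_diffP dg.
have dgf : differentiable (g \o f) x by exact/differentiable_comp.
apply: DeriveDef; first exact/derivable1_diffP.
rewrite deriveE // diff_comp // !derive1E' //= -[X in 'd  _ _ X = _]mulr1.
by rewrite [LHS]linearZ.
Qed.

Lemma Ck_comp {V} k D D' (f : R -> R) (g : R -> V) : open D ->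
  (forall x, D x -> D' (f x)) -> Ck k D f -> Ck k D' g -> Ck k D (g \o f).
Proof.
move=> oD fD; elim: k g => [//|k IH] g kf' kg'.
have /CkSP[df kf] := kf'; have /CkSP[dg kg] := kg'.
have H x : D x -> is_derive x 1 (g \o f) (derive1 f x *: derive1 g (f x)).
  by move=> Dx; apply: is_derive_comp; [exact: df|exact/dg/fD].
apply/CkSP; split=> [x /H[]//|].
apply: (Ck_eq _ _ _ (fun x => derive1 f x *: (derive1 g \o f) x)) => //.
  by move=> x /H[_ <-]; rewrite derive1E.
exact: Ck_scale oD kf (IH _ (Ck_le _ _ _ _ (leqnSn k) kf') kg).
Qed.

Lemma Ck_id k D : Ck k D (@id R).
Proof.
case: k => [//|k]; apply/CkSP; split=> [x _|]; first exact: derivable_id.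
rewrite (_ : derive1 _ = fun=> 1 : R); first exact: Ck_cst.
by apply/funext => x; rewrite derive1_id.
Qed.

End Ck.

(** * A flat function at 0 and a smooth step *)

Section FlatFunction.
Context {R : realType}.

(* The factor [x^-m] closes the family under derivation:
   flatexp m ' = flatexp (m + 2) - m flatexp (m + 1). *)
Definition flatexp (m : nat) (x : R) : R :=
  if x <= 0 then 0 else x^-1 ^+ m * expR (- x^-1).

Lemma flatexp_le0 m x : x <= 0 -> flatexp m x = 0.
Proof. by rewrite /flatexp => ->. Qed.

Lemma flatexp_ge0 m x : 0 <= flatexp m x.
Proof.
rewrite /flatexp; case: ifPn => //; rewrite -ltNge => x0.
by rewrite mulr_ge0 ?expR_ge0// exprn_ge0// invr_ge0 ltW.
Qed.

(** With y = 1/x this is exp y >= y^(m+2) / (m+2)!. A bound of order x^2 forces the derivative at 0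
    to vanish. *)
Lemma flatexp_le m x : flatexp m x <= m.+2`!%:R * x ^+ 2.
Proof.
rewrite /flatexp; case: ifPn => [_|]; first by rewrite mulr_ge0// sqr_ge0.
rewrite -ltNge => x0; set y := x^-1.
have y0 : 0 < y by rewrite invr_gt0.
rewrite expRN -ler_pdivlMr ?invr_gt0 ?expR_gt0// invrK.
have f0 : 0 < m.+2`!%:R :> R by rewrite ltr0n fact_gt0.
have := expR_ge1Dxn m.+1 (ltW y0).
move=> /(le_trans (ler_wpDl ler01 (lexx _))) H.
rewrite (_ : y ^+ m = m.+2`!%:R * x ^+ 2 * (y ^+ m.+2 / m.+2`!%:R)).
  by rewrite ler_wpM2l// mulr_ge0 ?sqr_ge0// ltW.
rewrite -addn2 exprD mulrACA [x ^+ 2 * _]mulrC mulrACA divff ?gt_eqF// mul1r.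
by rewrite -mulrA -exprMn [y * x]mulVf ?gt_eqF// expr1n mulr1.
Qed.

Lemma is_derive_flatexp m (x : R) :
  is_derive x 1 (flatexp m) (flatexp m.+2 x - m%:R * flatexp m.+1 x).
Proof.
have [x0|x0|->] := ltgtP x 0.
- rewrite /flatexp (ltW x0) mulr0 subr0.
  apply: (@near_eq_is_derive _ _ _ (fun=> 0 : R)).
    near=> y; rewrite ifT//; apply: ltW; near: y.
    exact: lt_nbhsl.
- rewrite /flatexp leNgt x0 /=.
  apply: (@near_eq_is_derive _ _ _ (fun y : R => y^-1 ^+ m * expR (- y^-1))).
    near=> y; rewrite ifF//; apply/negbTE; rewrite -ltNge; near: y.
    exact: lt_nbhsr.
  have xn0 : x != 0 by rewrite gt_eqF.
  have Hi : is_derive x 1 (fun y : R => y^-1) (- x^-1 ^+ 2).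
    apply: DeriveDef; first exact: (@derivableV _ _ id).
    by rewrite (@deriveV _ _ id)// derive_id [_ *: _]mulr1 exprVn.
  have He : is_derive x 1 (expR \o (fun y : R => - y^-1))
      (expR (- x^-1) * (x^-1 ^+ 2)).
    by apply: is_derive1_comp; rewrite -[x^-1 ^+ 2]opprK; exact: is_deriveN.
  have HX := is_deriveX m Hi.
  have := is_deriveM HX He.
  rewrite (_ : ((fun y : R => y^-1) ^+ m) * _ =
      (fun y : R => y^-1 ^+ m * expR (- y^-1))); last first.
    by apply/funext => y; rewrite exprfctE.
  move=> /is_derive_eq; apply.
  rewrite exprfctE /= -![_ *: _]/(_ * _); set y := x^-1; set E := expR _.
  by case: (m) => [|p] /=; rewrite ?expr0 !exprS; ring.
(* At 0 the claimed derivative is 0, and the quadratic bound makes the difference quotient at most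
   [C] times |h|. *)
- have := flatexp_le m.
  set C := _%:R => H.
  have C0 : 0 < C by rewrite /C ltr0n fact_gt0.
  rewrite /flatexp lexx mulr0 subr0 -/(flatexp m).
  suff E : h^-1 *: ((flatexp m \o shift (0 : R)) (h *: 1) - flatexp m 0)
      @[h --> 0^'] --> (0 : R).
    by apply: DeriveDef; [exact: cvgP E|exact: cvg_lim E].
  apply/cvgr0Pnorm_le => e e0.
  near=> h => /=.
  rewrite addr0 [h *: 1]mulr1 {2}/flatexp lexx subr0.
  have hn0 : h != 0 by near: h; exact: nbhs_dnbhs_neq.
  rewrite normrZ normfV ler_pdivrMl ?normr_gt0// ger0_norm ?flatexp_ge0//.
  apply: le_trans (H _) _; rewrite -real_normK ?num_real// mulrCA ler_wpM2l//.
  rewrite -ler_pdivlMl; last exact: C0.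
  near: h; apply: dnbhs0_le; rewrite mulr_gt0// invr_gt0; exact: C0.
Unshelve. all: by end_near. Qed.

Lemma Ck_flatexp (k m : nat) (D : set R) : open D -> Ck k D (flatexp m).
Proof.
move=> oD; elim: k m => [//|k IH] m; apply/CkSP; split=> [x _|].
  by have [] := is_derive_flatexp m x.
rewrite (_ : derive1 _ = fun x => flatexp m.+2 x + (- m%:R) *: flatexp m.+1 x).
  by apply: CkD => //; apply: Ck_scale => //; exact: Ck_cst.
apply/funext => x; rewrite derive1E.
by have [_ ->] := is_derive_flatexp m x; rewrite [_ *: _]mulNr.
Qed.

(** Nesting [flatexp 0] keeps the denominator constant, so smoothness follows from composition and
    scaling alone. The inner difference is [flatexp 0 1] for x <= 0 and is nonpositive for x >= 1,
    which gives the values 0 and 1 there. *)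
Definition smoothstep (x : R) : R :=
  1 - flatexp 0 (flatexp 0 1 - flatexp 0 x) / flatexp 0 (flatexp 0 1).

Lemma flatexp0_gt0 x : 0 < x -> 0 < flatexp 0 x.
Proof. by move=> x0; rewrite /flatexp leNgt x0/= expr0 mul1r expR_gt0. Qed.

Lemma flatexp0_nondecreasing : {homo flatexp 0 : x y / x <= y}.
Proof.
move=> x y xy; rewrite {1}/flatexp; case: ifPn => [_|].
  exact: flatexp_ge0.
rewrite -ltNge => x0; have y0 := lt_le_trans x0 xy.
by rewrite /flatexp (lt_geF y0) !expr0 !mul1r ler_expR lerN2 lef_pV2.
Qed.

Lemma smoothstep0 x : x <= 0 -> smoothstep x = 0.
Proof.
move=> x0; rewrite /smoothstep (flatexp_le0 _ x) // subr0.
rewrite divff ?subrr// gt_eqF//.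
by do 2 apply: flatexp0_gt0.
Qed.

Lemma smoothstep1 x : 1 <= x -> smoothstep x = 1.
Proof.
move=> x1; rewrite /smoothstep flatexp_le0 ?mul0r ?subr0//.
by rewrite subr_le0 flatexp0_nondecreasing.
Qed.

Lemma smoothstep_itv x : 0 <= smoothstep x <= 1.
Proof.
have c0 : 0 < flatexp 0 (flatexp 0 1) by do 2 apply: flatexp0_gt0.
rewrite /smoothstep subr_ge0 lerBlDr lerDl divr_ge0 ?flatexp_ge0// andbT.
rewrite ler_pdivrMr// mul1r flatexp0_nondecreasing// lerBlDr lerDl.
exact: flatexp_ge0.
Qed.

Lemma Ck_smoothstep (k : nat) : Ck k setT smoothstep.
Proof.
have oT := @openT R.
pose c := flatexp 0 1.
rewrite (_ : smoothstep = fun x => 1 + (- (flatexp 0 c)^-1) *: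
    (flatexp 0 \o (fun x => c + (-1) *: flatexp 0 x)) x).
  apply: CkD => //; first exact: Ck_cst.
  apply: Ck_scale => //; first exact: Ck_cst.
  apply: (Ck_comp _ _ setT) => //; last exact: Ck_flatexp.
  apply: CkD => //; first exact: Ck_cst.
  by apply: Ck_scale => //; [exact: Ck_cst|exact: Ck_flatexp].
apply/funext => x; rewrite /smoothstep /=.
by rewrite -![_ *: _]/(_ * _) mulN1r mulNr mulrC.
Qed.

End FlatFunction.

(** * Smooth paths in a submanifold, at rest at both ends *)

Section SmoothCurves.
Context {R : realType} {V : normedModType R}.
Implicit Types (f : R -> V) (N : set V).

Lemma Ck_continuous f : Ck 1 setT f -> continuous f.
Proof.
move=> kf x; have /derivable1_diffP := kf 0%N (ltnSn _) x I.
exact: differentiable_continuous.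
Qed.

Lemma smooth_on_Ck f : smooth_on setT f -> forall k, Ck k setT f.
Proof.
move=> sf k j _ x _.
have -> : derive1n j f = iter_dir (nseq j (1 : R)) f.
  by elim: j => [//|j IH]; apply/funext => y; rewrite derive1nS derive1E IH.
by have [_] := sf (nseq j (1 : R)) x I.
Qed.

Lemma deriveE_derive1 f (x v : R) : derivable f x 1 ->
  derivable f x v /\ 'D_v f x = v *: derive1 f x.
Proof.
move=> df; have /derivable1_diffP df' := df; split; first exact: diff_derivable.
by rewrite deriveE// deriv1E.
Qed.

(** On the real line, an iterated directional derivative is the product of the directions times the
    ordinary derivative of the same order. *)
Lemma Ck_smooth_on f : (forall k, Ck k setT f) -> smooth_on setT f.
Proof.
move=> kf; have df j x : derivable (derive1n j f) x 1 by exact: (kf j.+1 j).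
have itE vs : iter_dir vs f =
    fun x => (\prod_(v <- vs) v) *: derive1n (size vs) f x.
  elim: vs => [|v vs IH]; apply/funext => x.
    by rewrite /= big_nil scale1r.
  have [dv vE] := deriveE_derive1 _ x v (df (size vs) x).
  rewrite /= IH (deriveZ _ dv) vE big_cons scalerA mulrC.
  by [].
move=> vs x _; rewrite itE; set c := \prod_(v <- vs) v.
have dc : derivable (fun x => c *: derive1n (size vs) f x) x 1.
  exact: derivableZ.
split=> [|v]; last by have [] := deriveE_derive1 _ x v dc.
by have /derivable1_diffP/differentiable_continuous := dc.
Qed.

Lemma is_derive_line (W : normedModType R) (F : V -> W) (y v : V) (t : R) :
  derivable F (y + t *: v) v ->
  is_derive t 1 (fun t => F (y + t *: v)) ('D_v F (y + t *: v)).
Proof.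
move=> dF.
have E : (fun h : R => h^-1 *: (((fun t => F (y + t *: v)) \o shift t) (h *: 1)
      - F (y + t *: v))) =
    (fun h => h^-1 *: ((F \o shift (y + t *: v)) (h *: v) - F (y + t *: v))).
  by apply/funext => h /=; rewrite [h *: 1]mulr1 scalerDl addrCA.
by apply: DeriveDef; rewrite /derivable ?/derive E.
Qed.

Lemma open_line (U : set V) (y v : V) :
  open U -> open [set t : R | U (y + t *: v)].
Proof.
move=> oU; apply: (@open_comp _ _ (fun t : R => y + t *: v)) => // t _.
apply: cvgD; first exact: cvg_cst.
by apply: cvgZ => //; exact: cvg_cst.
Qed.

(** [smooth_on] speaks of directional derivatives only. Along a line these suffice: the j-th
    derivative in [t] is [F] differentiated j times in the fixed direction [v]. *)
Lemma Ck_line (W : normedModType R) (U : set V) (F : V -> W) (y v : V) k :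
  open U -> smooth_on U F ->
  Ck k [set t | U (y + t *: v)] (fun t => F (y + t *: v)).
Proof.
move=> oU sF; have oD := open_line U y v oU.
have dF j t : U (y + t *: v) -> is_derive t 1
    (fun t => iter_dir (nseq j v) F (y + t *: v))
    (iter_dir (nseq j.+1 v) F (y + t *: v)).
  by move=> Ut; apply: is_derive_line; have [_] := sF (nseq j v) _ Ut.
have E j : forall t, U (y + t *: v) -> derive1n j (fun t => F (y + t *: v)) t =
    iter_dir (nseq j v) F (y + t *: v).
  elim: j => [//|j IH] t Ut; have [_ <-] := dF j t Ut.
  rewrite derive1nS -derive1E; apply: near_eq_derive1.
  near=> s; apply: IH; near: s; exact: open_nbhs_nbhs.
move=> j _ t Dt; have [dt _] := dF j t Dt; apply: near_eq_derivable dt.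
near=> s; rewrite E//; near: s; exact: open_nbhs_nbhs.
Unshelve. all: by end_near. Qed.

Definition flat_path N (p q : V) := exists c : R -> V,
  [/\ forall k, Ck k setT c, forall x, N (c x),
      forall x, x <= 0 -> c x = p & forall x, 1 <= x -> c x = q].

Lemma flat_path_cst N p : N p -> flat_path N p p.
Proof. by move=> Np; exists (fun=> p); split=> // k; exact: Ck_cst. Qed.

Lemma Ck_affine (a b : R) k : Ck k setT (fun x : R => a * x + b).
Proof.
have oT := @openT R; apply: CkD => //; last exact: Ck_cst.
by apply: (Ck_scale k setT (fun=> a)) => //; [exact: Ck_cst|exact: Ck_id].
Qed.

Lemma Ck_comp_affine (a b : R) k f :
  Ck k setT f -> Ck k setT (fun x : R => f (a * x + b)).
Proof.
move=> kf; apply: (Ck_comp k setT setT (fun x => a * x + b) f) => //.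
- exact: openT.
- exact: Ck_affine.
Qed.

Lemma flat_path_sym N p q : flat_path N p q -> flat_path N q p.
Proof.
move=> [c [kc Nc c0 c1]]; exists (fun x => c (-1 * x + 1)); split=> //.
- by move=> k; exact: Ck_comp_affine.
- by move=> x x0; apply: c1; lra.
- by move=> x x0; apply: c0; lra.
Qed.

(* At each time at most one of the two summands differs from [q]. *)
Lemma flat_path_trans N p q r :
  flat_path N p q -> flat_path N q r -> flat_path N p r.
Proof.
move=> [c [kc Nc c0 c1]] [d [kd Nd d0 d1]].
exists (fun x => c (2 * x + 0) + d (2 * x + -1) + - q).
have oT := @openT R.
split=> [k|x|x x0|x x1].
- apply: CkD => //; last exact: Ck_cst.
  by apply: CkD => //; exact: Ck_comp_affine.
- have [x2|x2] := leP (2 * x) 1.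
    by rewrite d0 ?addrK//; lra.
  by rewrite c1 1?addrAC ?subrr ?add0r//; lra.
- by rewrite d0 ?addrK ?c0//; lra.
- by rewrite c1 1?addrAC ?subrr ?add0r ?d1//; lra.
Qed.

(* In a chart straightening [N], the segment between the images of two nearby
   points stays in the linear subspace; directional derivatives of the inverse
   chart along that segment are all that smoothness requires. *)
Lemma flat_path_local N p : submanifold N -> N p ->
  \forall q \near p, N q -> flat_path N p q.
Proof.
move=> sN Np.
have [U [U' [Phi [Psi [E [[oU Up oU' [E0 EP]] [sPhi sPsi] PhiK PsiK NE]]]]]] :=
  sN p Np.
have [U'p _] := PhiK p Up.
have /nbhs_ballP[r /= r0 rU'] : nbhs (Phi p) U' by exact: open_nbhs_nbhs.
have cPhi : {for p, continuous Phi} by have [] := sPhi [::] p Up.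
have nU : \forall q \near p, U q by exact: open_nbhs_nbhs.
have nB : \forall q \near p, `|Phi q - Phi p| < r.
  have /cvgrPdist_lt/(_ _ r0) := cPhi.
  by apply: filterS => q; rewrite distrC.
near=> q => Nq.
have Uq : U q by near: q.
have vr : `|Phi q - Phi p| < r by near: q.
set y := Phi p; set v := Phi q - y.
(* The segment stays in the ball of radius [r] around [Phi p], hence in the domain of [Psi]. *)
have U's (s : R) : 0 <= s <= 1 -> U' (y + s *: v).
  move=> /andP[s0 s1]; apply: rU'; rewrite -ball_normE /= opprD addNKr normrN.
  rewrite normrZ ger0_norm//; apply: le_lt_trans vr.
  by rewrite ler_piMl.
have Es (s : R) : E (y + s *: v).
  have Ey : E y by apply/NE.
  have Eq : E (Phi q) by apply/NE.
  rewrite addrC; apply: (EP s v y) => //.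
  by have := EP (-1) _ _ Ey Eq; rewrite scaleN1r addrC.
(* [smoothstep] brings the path to rest at both ends and keeps the parameter in [0, 1], where the
   segment is known to lie in [U']. *)
exists (fun x => Psi (y + smoothstep x *: v)); split.
- move=> k.
  apply: (Ck_comp k setT [set s | U' (y + s *: v)] smoothstep
    (fun s => Psi (y + s *: v))).
  + exact: openT.
  + by move=> x _; apply: U's; exact: smoothstep_itv.
  + exact: Ck_smoothstep.
  + exact: Ck_line.
- move=> x; have [Ux Ex] := PsiK _ (U's _ (smoothstep_itv x)).
  by apply/NE => //; rewrite Ex.
- by move=> x x0; rewrite smoothstep0// scale0r addr0; have [] := PhiK p Up.
- move=> x x1; rewrite smoothstep1// scale1r /v addrC subrK.
  by have [] := PhiK q Uq.
Unshelve. all: by end_near. Qed.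

(** The points reachable from [p] form a nonempty subset that is open and closed in [N]: by
    [flat_path_local], points of [N] close to [x] are reachable exactly when [x] is. *)
Lemma connected_flat_path N p q : submanifold N -> connected N ->
  N p -> N q -> flat_path N p q.
Proof.
move=> sN cN Np Nq.
pose B := [set x | N x /\ flat_path N p x].
(* [O A] is the interior of the union of [A] and the complement of [N]: an open set of the ambient
   space whose trace on [N] is the relative interior of [A], for [A] inside [N] or not. *)
pose O (A : set V) := [set x : V | \forall y \near x, N y -> A y].
have oO A : open (O A).
  by rewrite openE => x /near_join; apply: filterS => y; exact.
have ON A x : N x -> O A x -> A x by move=> Nx /nbhs_singleton; exact.
suff BN : B = N by have [] : B q by rewrite BN.
apply: cN; first by exists p; split => //; exact: flat_path_cst.
- exists (O B) => //; apply/seteqP; split=> x; last by move=> [Nx]; exact: ON.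
  move=> [Nx px]; split=> //; apply: filterS (flat_path_local N x sN Nx).
  by move=> y xy Ny; split=> //; apply: flat_path_trans px (xy Ny).
- exists (~` O (~` B)); first exact: open_closedC.
  apply/seteqP; split=> x [Nx].
    by move=> px; split=> // /(ON _ _ Nx); apply; split.
  move=> nO; apply: contrapT => nB; apply: nO.
  apply: filterS (flat_path_local N x sN Nx) => y xy Ny [_ py]; apply: nB.
  by split=> //; apply: flat_path_trans py (flat_path_sym _ _ _ (xy Ny)).
Qed.

End SmoothCurves.

(** * Fractional part and periodic extension *)

Section Periodization.
Context {R : realType}.

Definition fract (x : R) : R := x - (Num.floor x)%:~R.

Lemma fract_itv x : 0 <= fract x < 1.
Proof.
have /andP[h1 h2] := floor_itv x; move: h2; rewrite intrD => h2.
by rewrite /fract; apply/andP; split; lra.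
Qed.

Lemma fract_id x : 0 <= x < 1 -> fract x = x.
Proof.
by move=> x01; rewrite /fract (@floor_def _ x 0) ?subr0// add0r.
Qed.

Lemma fract_periodic : periodic1 fract.
Proof.
move=> x; rewrite /fract floorDrz ?rpred1// floor1 intrD.
by rewrite opprD addrACA subrr addr0.
Qed.

Lemma periodic1_fract (T : Type) (g : R -> T) x :
  periodic1 g -> g (fract x) = g x.
Proof.
move=> pg; have pn (k : nat) y : g (y + k%:R) = g y.
  by elim: k => [|k IH]; rewrite ?addr0// -natr1 addrA pg.
rewrite /fract; case: (Num.floor x) => k; first by rewrite -(pn k) subrK.
by rewrite NegzE intrN opprK pn.
Qed.

(** Loops of the form [g \o fract] may jump at the integers, so their measurability cannot come from
    continuity. *)
Lemma measurable_fract : measurable_fun setT fract.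
Proof.
apply: measurable_funB => //.
apply: (measurability (@RGenCInfty.G R)) => [|/= _ [_] [r] -> <-].
  exact: RGenCInfty.measurableE.
rewrite setTI (_ : _ @^-1` _ = `[(Num.ceil r)%:~R, +oo[%classic) //.
apply/seteqP; split=> x; rewrite /= !in_itv /= !andbT.
  by rewrite -ceil_le_int floor_ge_int.
by rewrite -floor_ge_int ceil_le_int.
Qed.

Lemma Ck_periodize {V : normedModType R} (f : R -> V) b k : Ck k setT f ->
  (forall x, x <= 0 -> f x = b) -> (forall x, 1 <= x -> f x = b) ->
  Ck k setT (f \o fract).
Proof.
move=> kf f0 f1; apply: Ck_near => x _; set m := (Num.floor x)%:~R : R.
have /andP[mx xm1] := floor_itv x; rewrite intrD -/m in mx xm1.
(* With [m] the floor of [x], this agrees with [f \o fract] on ]m - 1, m + 1[: the second summand is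
   [b] from [m] on, and the first is [b] before [m]. *)
exists (fun y => f (1 * y + - m) + f (1 * y + (1 - m)) + - b); last first.
  have oT := @openT R; apply: CkD => //; last exact: Ck_cst.
  by apply: CkD => //; exact: Ck_comp_affine.
near=> y.
have ym1 : y < m + 1 by near: y; exact: lt_nbhsl.
have my1 : m - 1 < y by near: y; apply: lt_nbhsr; lra.
rewrite /= !mul1r /fract; have [my|ym] := leP m y.
  rewrite (@floor_def _ y (Num.floor x)) -/m ?intrD ?my//.
  by rewrite (f1 (y + (1 - m))) ?addrK//; lra.
rewrite (@floor_def _ y (Num.floor x - 1)) ?subrK ?intrB -/m; last first.
  by rewrite ym ltW.
rewrite (f0 (y - m)); last by lra.
rewrite addrAC subrr add0r.
by rewrite opprB.
Unshelve. all: by end_near. Qed.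

End Periodization.

(** * Smooth loops with prescribed base point following a given curve *)

Section BasedLoops.
Context {R : realType} {V : normedModType R}.
Implicit Types (N : set V) (g : R -> V).

Lemma continuous_bounded01 g : continuous g ->
  exists M, forall x, 0 <= x <= 1 -> `|g x| <= M.
Proof.
move=> cg; have cn : {within `[0, 1]%classic, continuous (fun x => `|g x|)}.
  apply: continuous_subspaceT => x; apply: cvg_norm; exact: cg.
have [c _ cM] := EVT_max ler01 cn.
by exists `|g c| => x x01; apply: cM; rewrite in_itv.
Qed.

(** A cutoff: for small positive [d] it vanishes outside ]d, 1 - d[ and equals 1 on [2d, 1 - 2d]. *)
Definition plateau (d x : R) : R :=
  smoothstep (x / d - 1) * smoothstep ((1 - x) / d - 1).

Lemma Ck_plateau d k : Ck k setT (plateau d).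
Proof.
have oT := @openT R.
apply: Ck_scale => //.
  rewrite (_ : (fun x => _) = fun x => smoothstep (d^-1 * x + -1)).
    by apply: Ck_comp_affine; exact: Ck_smoothstep.
  by apply/funext => x; rewrite mulrC.
rewrite (_ : (fun x => _) = fun x => smoothstep (- d^-1 * x + (d^-1 - 1))).
  by apply: Ck_comp_affine; exact: Ck_smoothstep.
by apply/funext => x; congr smoothstep; ring.
Qed.

(* At each time at most one of the three non-constant summands of [f] below
   differs from [g 0]: [c] runs from [b] to [g 0] near 0 and back near 1, and
   [g \o w] is used in between. *)
Lemma based_loop_approx N g b :
  (forall k, Ck k setT g) -> (forall x, N (g x)) ->
  flat_path N b (g 0) ->
  exists M, forall d, 0 < d -> d < 4^-1 -> exists h : R -> V,
    [/\ smooth_on setT h /\ periodic1 h, forall x, N (h x), h 0 = b,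
        forall x, `|h x| <= M &
        forall x, 2 * d <= x <= 1 - 2 * d -> h x = g x].
Proof.
move=> kg Ng [c [kc Nc c0 c1]].
have [M1 HM1] := continuous_bounded01 g (Ck_continuous _ (kg 1%N)).
have [M2 HM2] := continuous_bounded01 c (Ck_continuous _ (kc 1%N)).
have cM2 x : `|c x| <= M2.
  have [x0|x0] := leP x 0; first by rewrite c0// -(c0 0)// HM2// lexx ler01.
  have [x1|x1] := leP x 1; first by rewrite HM2// x1 ltW.
  by rewrite (c1 _ (ltW x1)) -(c1 1)// HM2// lexx ler01.
(* The bound is fixed before [d]: all values of the loop are values of [c], or of [g] on [0, 1]. *)
exists (Num.max M1 M2) => d d0 d4.
have oT := @openT R.
(* [w] is the identity in the middle and comes back to 0 by time 1 - d, so [g \o w] quickly retraces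
   [g] back to [g 0]. This closes up a curve with [g 1] different from [g 0]. *)
pose w x := x * plateau d x.
have ge1 x : d <= x -> 1 <= x / d by move=> dx; rewrite ler_pdivlMr// mul1r.
have le1 x : x <= d -> x / d <= 1 by move=> dx; rewrite ler_pdivrMr// mul1r.
have w0 x : x <= d -> w x = 0.
  by move=> /le1 xd; rewrite /w /plateau smoothstep0 ?mul0r ?mulr0//; lra.
have w1 x : 1 - d <= x -> w x = 0.
  move=> xd; have /le1 H : 1 - x <= d by lra.
  by rewrite /w /plateau (smoothstep0 ((1 - x) / d - 1)) ?mulr0//; lra.
have w01 x : 0 <= w x <= 1.
  have [/w0->|xd] := leP x d; first by rewrite lexx ler01.
  have [/w1->|x1d] := leP (1 - d) x; first by rewrite lexx ler01.
  have x0 : 0 <= x by lra.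
  have x1 : x <= 1 by lra.
  have H (s t : R) : 0 <= s <= 1 -> 0 <= t <= 1 -> 0 <= x * (s * t) <= 1.
    move=> /andP[s0 s1] /andP[t0 t1]; rewrite !mulr_ge0//=.
    by rewrite !mulr_ile1// mulr_ge0.
  exact: H (smoothstep_itv _) (smoothstep_itv _).
have wid x : 2 * d <= x <= 1 - 2 * d -> w x = x.
  move=> /andP[xd x1d].
  have H1 : 2 <= x / d by rewrite ler_pdivlMr.
  have H2 : 2 <= (1 - x) / d by rewrite ler_pdivlMr//; lra.
  by rewrite /w /plateau !smoothstep1 ?mulr1//; lra.
pose f x :=
  c (d^-1 * x + 0) + c (- d^-1 * x + d^-1) + (g \o w) x + - (g 0 *+ 2).
have kf k : Ck k setT f.
  apply: CkD => //; last exact: Ck_cst.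
  apply: CkD => //.
    by apply: CkD => //; exact: Ck_comp_affine.
  apply: (Ck_comp k setT setT w) => //.
  by apply: Ck_scale => //; [exact: Ck_id|exact: Ck_plateau].
have arg1 x : d^-1 * x + 0 = x / d by rewrite addr0 mulrC.
have arg2 x : - d^-1 * x + d^-1 = (1 - x) / d by ring.
have f_left x : x <= d -> f x = c (x / d).
  move=> xd; rewrite /f arg1 arg2 /= w0// (c1 ((1 - x) / d)).
    by rewrite -(addrA (c _)) -mulr2n addrK.
  by apply: ge1; lra.
have f_right x : 1 - d <= x -> f x = c ((1 - x) / d).
  move=> xd; rewrite /f arg1 arg2 /= w1// (c1 (x / d)).
    by rewrite [g 0 + c _]addrC -(addrA (c _)) -mulr2n addrK.
  by apply: ge1; lra.
have f_mid x : d <= x <= 1 - d -> f x = g (w x).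
  move=> /andP[xd x1d]; rewrite /f arg1 arg2 /= !c1 -?mulr2n.
  - by rewrite addrC addKr.
  - by apply: ge1; lra.
  - by apply: ge1; lra.
(* Used twice: with membership in [N], and with the norm bound. *)
have fcase (P : V -> Prop) : (forall x, P (c x)) ->
    (forall x, 0 <= x <= 1 -> P (g x)) -> forall x, P (f x).
  move=> Pc Pg x; have [/f_left->//|xd] := leP x d.
  have [/f_right->//|x1d] := leP (1 - d) x.
  by rewrite f_mid; [exact: Pg|rewrite !ltW].
have f0 x : x <= 0 -> f x = b.
  move=> x0; rewrite f_left ?c0//; last by lra.
  by rewrite mulr_le0_ge0// invr_ge0 ltW.
have f1 x : 1 <= x -> f x = b.
  move=> x1; rewrite f_right ?c0//; last by lra.
  by rewrite mulr_le0_ge0 ?invr_ge0 ?(ltW d0)//; lra.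
exists (f \o fract); split.
- split; last by move=> x; rewrite /= fract_periodic.
  by apply: Ck_smooth_on => k; apply: (Ck_periodize f b).
- by move=> x /=; apply: fcase.
- by rewrite /= f0// fract_id// lexx ltr01.
- move=> x /=; apply: (fcase (fun v => `|v| <= Num.max M1 M2)) => y.
    by rewrite le_max cM2 orbT.
  by move=> y01; rewrite le_max HM1.
- move=> x /andP[dx xd] /=; rewrite fract_id; last by apply/andP; split; lra.
  rewrite f_mid ?wid//; last by apply/andP; split; lra.
  by rewrite dx.
Qed.

End BasedLoops.

(** * Estimates for the squared L2 distance *)

Section L2.
Context {R : realType} {n : nat}.
Implicit Types (f g h : R -> cmx R n) (A : cmx R n).
Local Notation mu := (@lebesgue_measure R).

Lemma fro2_ge0 A : 0 <= fro2 A.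
Proof.
rewrite sumr_ge0// => i _; rewrite sumr_ge0// => j _.
by rewrite addr_ge0 ?sqr_ge0.
Qed.

Lemma ler_mx_entry (B : 'M[R]_n) i j : `|B i j| <= `|B|.
Proof.
rewrite {2}/Num.norm /= mx_normrE.
exact: (le_bigmax _ (fun ij : 'I_n * 'I_n => `|B ij.1 ij.2|) (i, j)).
Qed.

(** The norm on pairs of matrices is the largest absolute value of an entry, so each of the n^2
    index pairs contributes at most 2 M^2. *)
Lemma fro2_le A M : `|A| <= M -> fro2 A <= (2 * M ^+ 2) *+ n *+ n.
Proof.
rewrite prod_normE ge_max => /andP[A1 A2].
have sq (B : 'M[R]_n) i j : `|B| <= M -> B i j ^+ 2 <= M ^+ 2.
  move=> BM; have Bij := le_trans (ler_mx_entry B i j) BM.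
  rewrite -[_ ^+ 2]real_normK ?num_real// lerXn2r// nnegrE//.
  exact: le_trans Bij.
rewrite (_ : _ *+ n *+ n = \sum_(i < n) \sum_(j < n) 2 * M ^+ 2); last first.
  by rewrite !sumr_const card_ord.
apply: ler_sum => i _; apply: ler_sum => j _.
by rewrite mulr_natl mulr2n lerD// sq.
Qed.

Lemma fro2D A B : fro2 (A + B) <= 2 * fro2 A + 2 * fro2 B.
Proof.
rewrite /fro2 !mulr_sumr -big_split; apply: ler_sum => i _.
rewrite !mulr_sumr -big_split; apply: ler_sum => j _ /=; rewrite !mxE.
have H (a b : R) : (a + b) ^+ 2 <= 2 * a ^+ 2 + 2 * b ^+ 2.
  have := sqr_ge0 (a - b); nra.
by have := lerD (H (A.1 i j) (B.1 i j)) (H (A.2 i j) (B.2 i j)); lra.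
Qed.

(** By definition the first conjunct of [L2mem]. *)
Definition measurable_entries f := forall i j : 'I_n,
  measurable_fun setT (fun x => (f x).1 i j) /\
  measurable_fun setT (fun x => (f x).2 i j).

Lemma continuous_measurable_entries f : continuous f -> measurable_entries f.
Proof.
move=> cf i j; split; apply: continuous_measurable_fun => x.
  apply: (@continuous_comp _ _ _ f (fun A : cmx R n => A.1 i j)).
    exact: cf.
  apply: (@continuous_comp _ _ _ fst (fun B : 'M[R]_n => B i j)).
    exact: cvg_fst.
  exact: coord_continuous.
apply: (@continuous_comp _ _ _ f (fun A : cmx R n => A.2 i j)).
  exact: cf.
apply: (@continuous_comp _ _ _ snd (fun B : 'M[R]_n => B i j)).
  exact: cvg_snd.
exact: coord_continuous.
Qed.

Lemma measurable_entries_comp f (u : R -> R) :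
  measurable_entries f -> measurable_fun setT u -> measurable_entries (f \o u).
Proof.
move=> mf umeas i j; have [m1 m2] := mf i j; split.
  exact: measurableT_comp m1 umeas.
exact: measurableT_comp m2 umeas.
Qed.

Lemma measurable_fro2B f g : measurable_entries f -> measurable_entries g ->
  measurable_fun setT (fun x => fro2 (f x - g x)).
Proof.
move=> mf mg; rewrite /fro2.
apply: measurable_sum => i; apply: measurable_sum => j.
have [f1 f2] := mf i j; have [g1 g2] := mg i j.
have E (a b : 'M[R]_n) : (a - b) i j = a i j - b i j by rewrite !mxE.
by apply: measurable_funD; apply: measurable_funX => /=;
  under eq_fun do rewrite E; exact: measurable_funB.
Qed.

(** Used with [E] the whole line for uniform bounds, and with [E] the two ends of [0, 1] for
    functions that agree in the middle. *)
Lemma l2sq_le f g (E : set R) C :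
  measurable_entries f -> measurable_entries g ->
  measurable E -> 0 <= C ->
  (forall x, 0 <= x <= 1 -> fro2 (f x - g x) <= C * \1_E x) ->
  (l2sq f g <= C%:E * mu (E `&` `[0%R, 1%R]%classic))%E.
Proof.
move=> mf mg mE C0 H.
have mI : measurable_fun (`[0%R, 1%R]%classic : set R)
    (fun x => (\1_E x : R)%:E).
  by apply/measurable_EFinP; exact: measurable_indic.
rewrite -(integral_indic mu)// -ge0_integralZl_EFin//.
apply: ge0_le_integral => //.
- by move=> x _; rewrite lee_fin fro2_ge0.
- apply/measurable_EFinP; apply: measurable_funTS; exact: measurable_fro2B.
- by apply/measurable_EFinP; apply: measurable_funM.
Qed.

Lemma l2sq_le_cst f g C : measurable_entries f -> measurable_entries g ->
  0 <= C -> (forall x, 0 <= x <= 1 -> fro2 (f x - g x) <= C) ->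
  (l2sq f g <= C%:E)%E.
Proof.
move=> mf mg C0 H; apply: le_trans (l2sq_le f g setT C mf mg _ C0 _) _ => //.
  by move=> x /H; rewrite indicT mulr1.
by rewrite setTI lebesgue_measure_itv /= lte01 sube0 mule1.
Qed.

(** The factor 4 d is the total length of the two end intervals where [f] and [g] may differ. *)
Lemma l2sq_le_ends f g C d : measurable_entries f -> measurable_entries g ->
  0 <= C -> 0 <= d -> d < 4^-1 ->
  (forall x, 0 <= x <= 1 -> fro2 (f x - g x) <= C) ->
  (forall x, 2 * d <= x <= 1 - 2 * d -> f x = g x) ->
  (l2sq f g <= (4 * C * d)%:E)%E.
Proof.
move=> mf mg C0 d0 d4 H fg.
pose E := (`[0, 2 * d] `|` `[1 - 2 * d, 1])%classic : set R.
have mE : measurable E by apply: measurableU.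
apply: le_trans (l2sq_le f g E C mf mg _ C0 _) _ => //.
  move=> x /[dup] x01 /andP[x0 x1]; rewrite indicE.
  have [xd|xd] := leP x (2 * d).
    by rewrite mem_set ?mulr1 ?H//; left; rewrite /= in_itv /= x0.
  have [x1d|x1d] := leP (1 - 2 * d) x.
    by rewrite mem_set ?mulr1 ?H//; right; rewrite /= in_itv /= x1 x1d.
  rewrite fg ?subrr; last by rewrite !ltW.
  rewrite /fro2 big1 ?mulr_ge0// => i _; rewrite big1// => j _.
  by rewrite !mxE expr0n addr0.
rewrite (_ : 4 * C * d = C * (2 * d + 2 * d)); last by ring.
rewrite EFinM lee_wpmul2l ?lee_fin//.
have seg (a b : R) : a <= b -> mu `[a, b]%classic = (b - a)%:E.
  rewrite lebesgue_measure_itv /= lte_fin => ab.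
  by case: ltgtP ab => // ->; rewrite subrr.
apply: (@le_trans _ _ (mu E)).
  apply: le_measure; [apply/mem_set; exact: measurableI|exact/mem_set|].
  exact: subIsetl.
apply: (@le_trans _ _ ((2 * d - 0)%:E + (1 - (1 - 2 * d))%:E)%E); last first.
  by rewrite -EFinD lee_fin; lra.
by rewrite -!seg; [exact: measureU2|lra|lra].
Qed.

(** The pointwise bound [fro2D], integrated. Working with squared distances costs a factor 2 and
    avoids square roots. *)
Lemma l2sq_triangle f g h : measurable_entries f -> measurable_entries g ->
  measurable_entries h ->
  (l2sq f h <= 2%:E * l2sq f g + 2%:E * l2sq g h)%E.
Proof.
move=> mf mg mh.
have mF (u v : R -> cmx R n) : measurable_entries u -> measurable_entries v ->
    measurable_fun (`[0%R, 1%R]%classic : set R)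
      (fun x => (fro2 (u x - v x))%:E).
  move=> mu' mv; apply/measurable_EFinP; apply: measurable_funTS.
  exact: measurable_fro2B.
have F0 (u v : R -> cmx R n) x : (0 <= (fro2 (u x - v x))%:E)%E.
  by rewrite lee_fin fro2_ge0.
rewrite /l2sq -!ge0_integralZl_EFin//; [|exact: mF|exact: mF].
rewrite -ge0_integralD//.
- apply: ge0_le_integral => //.
  + exact: mF.
  + by apply: emeasurable_funD; apply: measurable_funeM; exact: mF.
  + move=> x _; rewrite -!EFinM -EFinD lee_fin.
    by rewrite -[f x - h x](subrKA (g x)) fro2D.
- by move=> x _; rewrite mule_ge0.
- by apply: measurable_funeM; exact: mF.
- by move=> x _; rewrite mule_ge0.
- by apply: measurable_funeM; exact: mF.
Qed.

End L2.

(** * Approximation by based loops and L2 continuity of the contraction *)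

Section LoopSpaces.
Context {R : realType} {n : nat}.
Implicit Types (N : set (cmx R n)) (g : R -> cmx R n).

Lemma measurable_entries_fract g :
  continuous g -> measurable_entries (g \o fract).
Proof.
move=> cg; apply: measurable_entries_comp; last exact: measurable_fract.
exact: continuous_measurable_entries.
Qed.

Lemma L2mem_fract g : continuous g -> L2mem (g \o fract).
Proof.
move=> cg; split; first exact: measurable_entries_fract.
have [M HM] := continuous_bounded01 g cg.
have C0 : 0 <= (2 * M ^+ 2) *+ n *+ n.
  by rewrite !mulrn_wge0// mulr_ge0 ?sqr_ge0.
have mz : measurable_entries (fun=> 0 : cmx R n).
  by apply: continuous_measurable_entries; exact: cst_continuous.
have := l2sq_le_cst _ (fun=> 0) _ (measurable_entries_fract g cg) mz C0.
move=> /(_ _)/le_lt_trans; apply; last exact: ltry.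
move=> x _; apply: fro2_le; rewrite subr0; apply: HM.
by have /andP[-> /ltW->] := fract_itv x.
Qed.

(** As [g] may fail to be periodic, the same statement treats genuine loops and the discontinuous
    loops met along the contraction. *)
Lemma fract_L2_approx N g b e :
  (forall k, Ck k setT g) -> (forall x, N (g x)) ->
  flat_path N b (g 0) -> 0 < e ->
  exists h, [/\ smooth_loops N h, h 0 = b & (l2sq (g \o fract) h < e%:E)%E].
Proof.
move=> kg Ng bg e0; have cg := Ck_continuous _ (kg 1%N).
have [M1 HM1] := continuous_bounded01 g cg.
have [M2 HM2] := based_loop_approx N g b kg Ng bg.
set C : R := (2 * (M1 + M2) ^+ 2) *+ n *+ n.
have C0 : 0 <= C by rewrite !mulrn_wge0// mulr_ge0 ?sqr_ge0.
(* The bound 1/8 keeps [d] below 1/4. The other one gives 4 C d < e, with [C + 1] in place of [C] to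
   avoid dividing by 0. *)
pose d := Num.min 8^-1 (e / (4 * (C + 1))).
have d0 : 0 < d.
  by rewrite lt_min invr_gt0 divr_gt0 ?andbT//= ?mulr_gt0// ltr_wpDl.
have d8 : d <= 8^-1 by rewrite ge_min lexx.
have dC : d * (4 * (C + 1)) <= e.
  by rewrite -ler_pdivlMr ?ge_min ?lexx ?orbT// mulr_gt0// ltr_wpDl.
have [|h [[sh ph] Nh h0 hM hg]] := HM2 d d0; first by lra.
exists h; split => //.
have ch := Ck_continuous _ (smooth_on_Ck _ sh 1%N).
apply: (@le_lt_trans _ _ (4 * C * d)%:E); last first.
  by rewrite lte_fin; apply: lt_le_trans dC; nra.
apply: l2sq_le_ends => //.
- exact: measurable_entries_fract.
- exact: continuous_measurable_entries.
- exact: ltW.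
- by lra.
- move=> x _; apply: fro2_le; apply: le_trans (ler_normB _ _) _.
  apply: lerD => //=; apply: HM1.
  by have /andP[-> /ltW->] := fract_itv x.
- move=> x /[dup] xd /andP[dx xd1]; rewrite hg//= fract_id//.
  by apply/andP; split; lra.
Qed.

(** On the compact interval [0, 1] the curves converge uniformly as [t] tends to [t0], and uniform
    convergence implies L2 convergence. *)
Lemma L2_continuous_contraction g : continuous g ->
  L2_continuous_path (fun t x => g ((1 - t) * fract x)).
Proof.
move=> cg t0 _ e e0.
pose C : R := 2 *+ n *+ n.
have C0 : 0 <= C by rewrite !mulrn_wge0.
(* Since [r] is at most 1, C r^2 <= C r < e. *)
pose r := Num.min 1 (e / (2 * (C + 1))).
have r0 : 0 < r by rewrite lt_min ltr01 divr_gt0// mulr_gt0// ltr_wpDl.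
have r1 : r <= 1 by rewrite ge_min lexx.
have rC : r * (2 * (C + 1)) <= e.
  by rewrite -ler_pdivlMr ?ge_min ?lexx ?orbT// mulr_gt0// ltr_wpDl.
have cgl (t : R) : continuous (fun x : R => g ((1 - t) * x)).
  move=> x; apply: (@continuous_comp _ _ _ (fun x : R => (1 - t) * x) g).
    exact: mulrl_continuous.
  exact: cg.
have : \forall t \near t0, `[0, 1]%classic `<=`
    [set x | `|g ((1 - t) * x) - g ((1 - t0) * x)| < r].
  (* Compactness of [0, 1] turns joint continuity at each (x, t0) into one neighbourhood of [t0]
     valid for all [x]. *)
  have /compact_near_coveringP nc := @segment_compact R 0 1.
  apply: (nc R (nbhs t0)
    (fun t x => `|g ((1 - t) * x) - g ((1 - t0) * x)| < r)) => x _.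
  pose G (z : R * R) := g ((1 - z.2) * z.1) - g ((1 - t0) * z.1).
  have cG : G z @[z --> (x, t0)] --> G (x, t0).
    apply: cvgB.
      apply: (@continuous_comp _ _ _ (fun z : R * R => (1 - z.2) * z.1) g).
        apply: cvgM; last exact: cvg_fst.
        by apply: cvgB; [exact: cvg_cst|exact: cvg_snd].
      exact: cg.
    apply: (@continuous_comp _ _ _ (fun z : R * R => z.1)
      (fun x => g ((1 - t0) * x))).
      exact: cvg_fst.
    exact: cgl.
  have G0 : G (x, t0) = 0 by rewrite /G subrr.
  rewrite G0 in cG.
  by have /cvgr0_norm_lt/(_ _ r0) := cG.
move=> /nbhs_ballP[d /= d0 Hd]; exists d => // t _ tt0.
apply: (@le_lt_trans _ _ (C * r ^+ 2)%:E); last first.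
  have rr : r ^+ 2 <= r by rewrite expr2 ler_piMl// ltW.
  have Cr : C * r ^+ 2 <= C * r by rewrite ler_wpM2l.
  have Cr0 : 0 <= C * r by rewrite mulr_ge0// ltW.
  by rewrite lte_fin; apply: lt_le_trans rC; lra.
apply: l2sq_le_cst.
- exact: (measurable_entries_fract (fun x => g ((1 - t) * x)) (cgl t)).
- exact: (measurable_entries_fract (fun x => g ((1 - t0) * x)) (cgl t0)).
- by rewrite mulr_ge0// sqr_ge0.
- move=> x _; rewrite /C mulrnAl mulrnAl; apply: fro2_le; apply: ltW.
  apply: (Hd t); first by rewrite -ball_normE /= distrC.
  by rewrite /= in_itv /=; have /andP[-> /ltW->] := fract_itv x.
Qed.

End LoopSpaces.

Theorem theorem2 (R : realType) (n : nat) (N : set (cmx R n)) :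
  submanifold N -> connected N -> N 0 ->
  L2loops0 N = L2loops N /\
  (forall gamma : R -> cmx R n, smooth_loops N gamma ->
     exists (p : R -> R -> cmx R n) (sigma : R -> cmx R n),
       [/\ p 0 = gamma /\ p 1 = sigma,
           (forall t, 0 <= t <= 1 -> L2loops N (p t)),
           L2_continuous_path p,
           piecewise_smooth_loop N sigma &
           null_homotopic N sigma]).
Proof.
move=> sN cN N0; split.
  apply/seteqP; split=> f [mf Hf]; split=> // e e0.
    by have [h [sh _] fh] := Hf e e0; exists h.
  (* Two approximations at squared distance e/4, each doubled by [l2sq_triangle], add up to [e]. *)
  have e4 : 0 < e / 4 by rewrite divr_gt0.
  have [g [pg [sg Ng]] fg] := Hf _ e4.
  have kg := smooth_on_Ck _ sg.
  have gE : g \o fract = g by apply/funext => x; exact: periodic1_fract.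
  have [h [hl h0]] := fract_L2_approx N g 0 _ kg Ng
    (connected_flat_path N _ _ sN cN N0 (Ng 0)) e4.
  rewrite gE => gh; exists h => //.
  have mg : measurable_entries g.
    by apply: continuous_measurable_entries; exact: Ck_continuous (kg 1%N).
  have mh : measurable_entries h.
    have [_ [sh _]] := hl; apply: continuous_measurable_entries.
    exact: Ck_continuous (smooth_on_Ck _ sh 1%N).
  apply: le_lt_trans (l2sq_triangle f g h mf.1 mg mh) _.
  have -> : e%:E = (2%:E * (e / 4)%:E + 2%:E * (e / 4)%:E)%E.
    by rewrite -!EFinM -EFinD; congr EFin; field.
  by apply: lteD; rewrite lte_pmul2l.
move=> g [pg [sg Ng]]; have kg := smooth_on_Ck _ sg.
have cg := Ck_continuous _ (kg 1%N).
pose p t x := g ((1 - t) * fract x).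
exists p, (fun=> g 0); split.
- split; apply/funext => x; rewrite /p; last by rewrite subrr mul0r.
  by rewrite subr0 mul1r periodic1_fract.
(* The [+ 0] gives [gt] the affine form expected by [Ck_comp_affine]. *)
- move=> t _; pose gt x := g ((1 - t) * x + 0).
  have kgt k : Ck k setT gt by exact: Ck_comp_affine.
  have Egt : p t = gt \o fract by apply/funext => x; rewrite /gt /= addr0.
  rewrite Egt; split.
    by apply: L2mem_fract; exact: Ck_continuous (kgt 1%N).
  move=> e e0; have Ngt x : N (gt x) by exact: Ng.
  (* The base point is [gt 0] itself, so the constant path serves as connecting path; the
     approximating loop closes by retracing [gt]. *)
  have [h [hl _ gh]] :=
    fract_L2_approx N gt _ e kgt Ngt (flat_path_cst N _ (Ngt 0)) e0.
  by exists h.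
- exact: L2_continuous_contraction.
- split; [by []|exact: cst_continuous|by move=> x; exact: Ng|].
  exists [:: 1]; split=> [||i _]; rewrite /= ?ltr01//.
  exists (fun=> g 0); last by [].
  by apply: Ck_smooth_on => k; exact: Ck_cst.
- exists (fun _ _ => g 0), (g 0).
  split; [exact: cst_continuous|by []|by []|by []|by move=> t x _; exact: Ng].
Qed.
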